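(* Let $\omega\in[0,1]$ and let $A\in\mathbb{C}^{m\times m}$, $B\in\mathbb{C}^{m\times n}$, $C\in\mathbb{C}^{n\times m}$, $D\in\mathbb{C}^{n\times n}$. Put $Q=\begin{pmatrix}D&-C\\-B&A\end{pmatrix}$ and suppose that $Q_\omega$ is a nonsingular M-matrix with $Q_\omega\mathbf{1}>0$. Let $\widetilde Q$ be a nonsingular M-matrix satisfying $\widetilde Q\le Q_\omega$ and $\widetilde Q\mathbf{1}>0$, partitioned as $\widetilde Q=\begin{pmatrix}\widetilde D&-\widetilde C\\-\widetilde B&\widetilde A\end{pmatrix}$, where $\widetilde A,\widetilde B,\widetilde C,\widetilde D$ have the same sizes as $A,B,C,D$, respectively. Let $\widetilde\Phi$ and $\widetilde\Psi$ be the minimal nonnegative solutions of $X\widetilde CX-X\widetilde D-\widetilde AX+\widetilde B=0$ and $Y\widetilde BY-Y\widetilde A-\widetilde DY+\widetilde C=0$, respectively. Then: 1. The equation $XCX-XD-AX+B=0$ ($X\in\mathbb{C}^{m\times n}$) has a unique solution $\Phi$ such that $|\Phi|\le\widetilde\Phi$. Moreover, $D-C\Phi$ is a nonsingular matrix whose diagonal entries are in the upper right of $L(z_\omega,0)$, and $\Phi$ is the unique extremal solution of this equation, i.e., the unique solution such that all eigenvalues of $D-C\Phi$ are in the upper right of $L(z_\omega,0)$. 2. The equation $YBY-YA-DY+C=0$ ($Y\in\mathbb{C}^{n\times m}$) has a unique solution $\Psi$ such that $|\Psi|\le\widetilde\Psi$. Moreover, $A-B\Psi$ is a nonsingular matrix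 whose diagonal entries are in the upper right of $L(z_\omega,0)$, and $\Psi$ is the unique extremal solution of this equation, i.e., the unique solution such that all eigenvalues of $A-B\Psi$ are in the upper right of $L(z_\omega,0)$.
   Context: For a complex square matrix $M$ and a real $\omega\in[0,1]$, the $\omega$-comparison matrix $M_\omega$ is the real matrix with entries $[M_\omega]_{ii}=\omega\,\mathrm{Re}([M]_{ii})+(1-\omega)\,\mathrm{Im}([M]_{ii})$ and $[M_\omega]_{ij}=-|[M]_{ij}|$ for $i\ne j$. A real square matrix $M$ is a nonsingular M-matrix if all its off-diagonal entries are nonpositive and $Mu>0$ for some vector $u>0$. $\mathbf{1}$ is the all-ones column vector; $|M|$ is the matrix of moduli of entries; inequalities between real matrices or vectors are entrywise. The minimal nonnegative solution of a real matrix equation is the entrywise smallest among its entrywise nonnegative solutions; for the two tilde equations (whose coefficient matrix $\widetilde Q$ is a nonsingular M-matrix) it is known to exist. With $\mathrm{j}$ the imaginary unit, $z_\omega=-(1-\omega)+\omega\mathrm{j}$ and $L(z_\omega,0)=\{l z_\omega: l\in\mathbb{R}\}$ is a line through the origin. A complex number $x$ is ''in the upper right of $L(z_\omega,0)$'' if $\omega\,\mathrm{Re}(x)+(1-\omega)\,\mathrm{Im}(x)>0$. *)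

(* Defs.v *)
From HB Require Import structures.
From mathcomp Require Import all_boot all_order all_algebra.
From mathcomp Require Import complex.
From mathcomp Require Import reals.

Set Implicit Arguments.
Unset Strict Implicit.
Unset Printing Implicit Defensive.

Import Order.TTheory GRing.Theory Num.Theory.
Local Open Scope ring_scope.

(* Entrywise comparisons; not to be confused with the row-space order %MS. *)
Definition mxle (R : numDomainType) m n (M N : 'M[R]_(m, n)) : Prop :=
  forall i j, M i j <= N i j.

Definition mxlt (R : numDomainType) m n (M N : 'M[R]_(m, n)) : Prop :=
  forall i j, M i j < N i j.

Definition nonsingular_Mmatrix (R : numDomainType) n (M : 'M[R]_n) : Prop :=
  (forall i j, i != j -> M i j <= 0) /\
  (exists u : 'cV[R]_n, mxlt 0 u /\ mxlt 0 (M *m u)).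

(* The modulus as an element of R: `|x| itself would live in R[i]. *)
Definition cmod (R : rcfType) (x : R[i]) : R := complex.Re `|x|.

Definition mxmod (R : rcfType) m n (M : 'M[R[i]]_(m, n)) : 'M[R]_(m, n) :=
  map_mx (@cmod R) M.

Definition omega_part (R : rcfType) (w : R) (x : R[i]) : R :=
  w * complex.Re x + (1 - w) * complex.Im x.

(* x is in the upper right of the line L(z_w, 0) through the origin
   directed by z_w = - (1 - w) + w j. *)
Definition upper_right (R : rcfType) (w : R) (x : R[i]) : Prop :=
  0 < omega_part w x.

Definition omega_comparison (R : rcfType) (w : R) n (M : 'M[R[i]]_n) :
    'M[R]_n :=
  \matrix_(i, j) if i == j then omega_part w (M i j) else - cmod (M i j).

(* X C X - X D - A X + B = 0. The dual equation Y B Y - Y A - D Y + C = 0 is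
   riccati D C B A Y. *)
Definition riccati (R : pzRingType) m n (A : 'M[R]_m) (B : 'M[R]_(m, n))
    (C : 'M[R]_(n, m)) (D : 'M[R]_n) (X : 'M[R]_(m, n)) : Prop :=
  X *m C *m X - X *m D - A *m X + B = 0.

Definition minimal_nonneg (R : numDomainType) m n
    (P : 'M[R]_(m, n) -> Prop) (X : 'M[R]_(m, n)) : Prop :=
  [/\ P X, mxle 0 X & forall Y, P Y -> mxle 0 Y -> mxle X Y].

Definition extremal_solution (R : rcfType) (w : R) m n (A : 'M[R[i]]_m)
    (B : 'M[R[i]]_(m, n)) (C : 'M[R[i]]_(n, m)) (D : 'M[R[i]]_n)
    (X : 'M[R[i]]_(m, n)) : Prop :=
  riccati A B C D X /\
  (forall a : R[i], eigenvalue (D - C *m X) a -> upper_right w a).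

(* Main.v *)
Require Import Defs.
From HB Require Import structures.
From mathcomp Require Import all_boot all_order all_algebra.
From mathcomp Require Import complex.
From mathcomp Require Import reals.
From mathcomp Require Import boolp classical_sets topology normedtype sequences.
From mathcomp Require Import ring lra.

Set Implicit Arguments.
Unset Strict Implicit.
Unset Printing Implicit Defensive.

Import Order.TTheory GRing.Theory Num.Theory.
Import numFieldNormedType.Exports.
Local Open Scope ring_scope.
Local Open Scope classical_set_scope.

(** The functional omega_part w is additive and bounded by the modulus, and it is
    positive exactly in the open half-plane above the line. Hence a complex matrix
    G whose omega-comparison matrix dominates a nonsingular M-matrix is invertible
    and has its spectrum in that half-plane: G v = 0 forces |v| = 0 by inverse
    positivity (comparison_unitmx, comparison_upper_right_eigenvalue).

    Existence. The Jacobi iteration for the complex Riccati equation, started at 0,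
    is compared with the same iteration for the tilde equation. The increments of
    the former are bounded by those of the latter (jacobi_majorized), which
    increases to the minimal solution PhiT (jacobi_iterates_cvg); so the complex
    iterates converge to a solution Phi with |Phi| <= PhiT
    (jacobi_limit_solution). The row sums of the real iterates stay at most 1
    (jacobi_row_sum), so those of PhiT are at most 1 too.

    Uniqueness. Two M-matrices govern the solutions: Dt - Ct PhiT, with certificate
    vector 1, and At - PhiT Ct, with certificate vector 1 - PhiT 1
    (dual_closed_loop_dominant). The first one is dominated by the comparison
    matrix of D - C X for every X with |X| <= PhiT, which makes every such
    solution extremal. The second one is dominated by the comparison matrix of
    A - Phi C. For a solution X the difference E = X - Phi satisfies the Sylvester
    equation E (D - C X) + (A - Phi C) E = 0 (riccati_sub_sylvester). When X is
    extremal, no eigenvalue of D - C X is the opposite of one of A - Phi C, and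
    E = 0 (sylvester_eq0).

    The dual equation is the same statement after exchanging A with D and B with
    C. *)

(** * Moduli and omega-parts *)

Lemma cmodE (R : rcfType) (x : R[i]) :
  cmod x = Num.sqrt (complex.Re x ^+ 2 + complex.Im x ^+ 2).
Proof. by case: x. Qed.

Lemma cmod0 (R : rcfType) : cmod (0 : R[i]) = 0.
Proof. exact: Normc.normc0. Qed.

Lemma cmod_eq0 (R : rcfType) (x : R[i]) : cmod x = 0 -> x = 0.
Proof. exact: Normc.eq0_normc. Qed.

Lemma cmod_ge0 (R : rcfType) (x : R[i]) : 0 <= cmod x.
Proof. by rewrite cmodE sqrtr_ge0. Qed.

Lemma cmodM (R : rcfType) (x y : R[i]) : cmod (x * y) = cmod x * cmod y.
Proof. exact: Normc.normcM. Qed.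

Lemma cmodV (R : rcfType) (x : R[i]) : cmod x^-1 = (cmod x)^-1.
Proof. exact: Normc.normcV. Qed.

Lemma cmodN (R : rcfType) (x : R[i]) : cmod (- x) = cmod x.
Proof. exact: normcN. Qed.

Lemma cmodD (R : rcfType) (x y : R[i]) : cmod (x + y) <= cmod x + cmod y.
Proof. exact: le_normcD. Qed.

Lemma cmod_sum (R : rcfType) (I : finType) (P : pred I) (F : I -> R[i]) :
  cmod (\sum_(i | P i) F i) <= \sum_(i | P i) cmod (F i).
Proof.
elim/big_ind2: _ => //; first by rewrite cmod0.
by move=> x a y b xa yb; apply: le_trans (cmodD _ _) (lerD xa yb).
Qed.

Lemma Re_le_cmod (R : rcfType) (x : R[i]) : `|complex.Re x| <= cmod x.
Proof. by rewrite cmodE -sqrtr_sqr ler_wsqrtr// lerDl sqr_ge0. Qed.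

Lemma Im_le_cmod (R : rcfType) (x : R[i]) : `|complex.Im x| <= cmod x.
Proof. by rewrite cmodE -sqrtr_sqr ler_wsqrtr// lerDr sqr_ge0. Qed.

Lemma omega_partD (R : rcfType) (w : R) (x y : R[i]) :
  omega_part w (x + y) = omega_part w x + omega_part w y.
Proof. by rewrite /omega_part !raddfD /=; ring. Qed.

Lemma omega_partN (R : rcfType) (w : R) (x : R[i]) :
  omega_part w (- x) = - omega_part w x.
Proof. by rewrite /omega_part !raddfN /=; ring. Qed.

(** This bound and additivity are all that is needed of the half-plane above the
    line: for every w in [0, 1] the functional omega_part w behaves as
    the real part does for w = 1. *)
Lemma omega_part_le_cmod (R : rcfType) (w : R) (x : R[i]) :
  0 <= w <= 1 -> omega_part w x <= cmod x.
Proof.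
move=> /andP[w0 w1].
have := Re_le_cmod x; have := Im_le_cmod x; rewrite /omega_part.
have := ler_norm (complex.Re x); have := ler_norm (complex.Im x).
nra.
Qed.

(** * Entrywise order on matrices *)

Lemma addmxE (V : nmodType) m n (M N : 'M[V]_(m, n)) i j :
  (M + N) i j = M i j + N i j.
Proof. by rewrite mxE. Qed.

Lemma oppmxE (V : zmodType) m n (M : 'M[V]_(m, n)) i j : (- M) i j = - M i j.
Proof. by rewrite mxE. Qed.

Lemma mxle_refl (R : numDomainType) m n (M : 'M[R]_(m, n)) : mxle M M.
Proof. by move=> i j. Qed.

Lemma mxle_trans (R : numDomainType) m n (N M P : 'M[R]_(m, n)) :
  mxle M N -> mxle N P -> mxle M P.
Proof. by move=> MN NP i j; apply: le_trans (MN i j) (NP i j). Qed.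

Lemma mxle_anti (R : numDomainType) m n (M N : 'M[R]_(m, n)) :
  mxle M N -> mxle N M -> M = N.
Proof. by move=> MN NM; apply/matrixP => i j; apply: le_anti; rewrite MN NM. Qed.

Lemma mxltW (R : numDomainType) m n (M N : 'M[R]_(m, n)) :
  mxlt M N -> mxle M N.
Proof. by move=> MN i j; apply: ltW. Qed.

Lemma mxlt_le_trans (R : numDomainType) m n (N M P : 'M[R]_(m, n)) :
  mxlt M N -> mxle N P -> mxlt M P.
Proof. by move=> MN NP i j; apply: lt_le_trans (MN i j) (NP i j). Qed.

Lemma mxle_lt_trans (R : numDomainType) m n (N M P : 'M[R]_(m, n)) :
  mxle M N -> mxlt N P -> mxlt M P.
Proof. by move=> MN NP i j; apply: le_lt_trans (MN i j) (NP i j). Qed.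

Lemma mxleD (R : numDomainType) m n (M N M' N' : 'M[R]_(m, n)) :
  mxle M M' -> mxle N N' -> mxle (M + N) (M' + N').
Proof. by move=> MM NN i j; rewrite !mxE lerD. Qed.

Lemma mxle0_sub (R : numDomainType) m n (M N : 'M[R]_(m, n)) :
  mxle 0 (N - M) <-> mxle M N.
Proof.
by split=> MN i j; have := MN i j; rewrite !mxE ?subr_ge0// -subr_ge0.
Qed.

Lemma mxlt0_sub (R : numDomainType) m n (M N : 'M[R]_(m, n)) :
  mxlt 0 (N - M) <-> mxlt M N.
Proof. by split=> MN i j; have := MN i j; rewrite !mxE subr_gt0. Qed.

Lemma mxle_mul (R : numDomainType) m n p (M M' : 'M[R]_(m, n)) (N N' : 'M[R]_(n, p)) :
  mxle 0 M -> mxle 0 N -> mxle M M' -> mxle N N' -> mxle (M *m N) (M' *m N').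
Proof.
move=> M0 N0 MM NN i j; rewrite !mxE; apply: ler_sum => k _.
have := M0 i k; have := N0 k j; rewrite !mxE => ? ?.
exact: ler_pM.
Qed.

Lemma mxle_mull (R : numDomainType) m n p (M : 'M[R]_(m, n)) (N N' : 'M[R]_(n, p)) :
  mxle 0 M -> mxle N N' -> mxle (M *m N) (M *m N').
Proof.
move=> M0 NN i j; rewrite !mxE; apply: ler_sum => k _.
by have := M0 i k; rewrite mxE => ?; apply: ler_wpM2l.
Qed.

Lemma mxle0_mul (R : numDomainType) m n p (M : 'M[R]_(m, n)) (N : 'M[R]_(n, p)) :
  mxle 0 M -> mxle 0 N -> mxle 0 (M *m N).
Proof. by move=> M0 N0; rewrite -(mulmx0 _ M); apply: mxle_mull. Qed.

Lemma mxle0_1 (R : numDomainType) n : mxle 0 (const_mx 1 : 'cV[R]_n).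
Proof. by move=> i j; rewrite !mxE ler01. Qed.

Arguments mxle0_1 {R n}.

Lemma mxlt0_1 (R : numDomainType) n : mxlt 0 (const_mx 1 : 'cV[R]_n).
Proof. by move=> i j; rewrite !mxE ltr01. Qed.

Arguments mxlt0_1 {R n}.

Lemma mxmod0 (R : rcfType) m n : mxmod (0 : 'M[R[i]]_(m, n)) = 0.
Proof. by apply/matrixP => i j; rewrite !mxE cmod0. Qed.

Lemma mxmod_ge0 (R : rcfType) m n (M : 'M[R[i]]_(m, n)) : mxle 0 (mxmod M).
Proof. by move=> i j; rewrite !mxE cmod_ge0. Qed.

Lemma mxmod_le_ge0 (R : rcfType) m n (Z : 'M[R[i]]_(m, n)) (T : 'M[R]_(m, n)) :
  mxle (mxmod Z) T -> mxle 0 T.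
Proof. exact: mxle_trans (mxmod_ge0 Z). Qed.

Lemma mxmodD (R : rcfType) m n (M N : 'M[R[i]]_(m, n)) :
  mxle (mxmod (M + N)) (mxmod M + mxmod N).
Proof. by move=> i j; rewrite !mxE cmodD. Qed.

Lemma mxmodM (R : rcfType) m n p (M : 'M[R[i]]_(m, n)) (N : 'M[R[i]]_(n, p)) :
  mxle (mxmod (M *m N)) (mxmod M *m mxmod N).
Proof.
move=> i j; rewrite !mxE; apply: le_trans (cmod_sum _ _) _.
by apply: ler_sum => k _; rewrite !mxE cmodM.
Qed.

Lemma mxmod_mul_le (R : rcfType) m n p (M : 'M[R[i]]_(m, n)) (N : 'M[R[i]]_(n, p))
    (M' : 'M[R]_(m, n)) (N' : 'M[R]_(n, p)) :
  mxle (mxmod M) M' -> mxle (mxmod N) N' -> mxle (mxmod (M *m N)) (M' *m N').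
Proof.
move=> MM NN; apply: mxle_trans (mxmodM _ _) _.
by apply: mxle_mul => //; apply: mxmod_ge0.
Qed.

(** * M-matrices and comparison matrices *)

(** The off-diagonal terms of (M *m u) i are nonpositive, so its positivity can
    only come from the diagonal term. *)
Lemma Zmatrix_gt0 (R : realDomainType) n (M : 'M[R]_n) (u : 'cV[R]_n) :
  (forall i j, i != j -> M i j <= 0) -> mxle 0 u -> mxlt 0 (M *m u) ->
  forall i, 0 < M i i /\ 0 < u i 0.
Proof.
move=> Moff u0 Mu0 i.
have {}u0 j : 0 <= u j 0 by have := u0 j 0; rewrite mxE.
have := Mu0 i 0; rewrite !mxE (bigD1 i)//= => Mui.
have Mu_i : 0 < M i i * u i 0.
  apply: lt_le_trans Mui _; rewrite gerDl; apply: sumr_le0 => j ji.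
  by rewrite mulr_le0_ge0// Moff// eq_sym.
have ui : 0 < u i 0.
  by rewrite lt_neqAle u0 eq_sym andbT; apply/eqP => ui; rewrite ui mulr0 ltxx in Mu_i.
by rewrite -(pmulr_lgt0 _ ui).
Qed.

(** Nonsingular M-matrices are inverse positive; the proof looks at a row where
    x_i / u_i is largest. *)
Lemma Mmatrix_inverse_positive (R : realFieldType) n (N : 'M[R]_n)
    (u x : 'cV[R]_n) :
  (forall i j, i != j -> N i j <= 0) -> mxlt 0 u -> mxlt 0 (N *m u) ->
  mxle (N *m x) 0 -> mxle x 0.
Proof.
move=> Noff u0 Nu0 Nx0 i j; rewrite (ord1 j) mxE leNgt; apply/negP => xi0.
have {}u0 k : 0 < u k 0 by have := u0 k 0; rewrite mxE.
pose k := [arg max_(k > i) (x k 0 / u k 0)]%O.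
have kmax l : x l 0 / u l 0 <= x k 0 / u k 0.
  by rewrite /k; case: Order.TotalTheory.arg_maxP => // k' _ /(_ l isT).
(* With t the largest ratio x_l / u_l, row k of N *m x is at least t times row k
   of N *m u, because off the diagonal N reverses x_l <= t u_l. *)
have t0 : 0 < x k 0 / u k 0 by apply: lt_le_trans (kmax i); rewrite divr_gt0.
move: t0 kmax; set t := x k 0 / u k 0 => t0 kmax.
have : t * (N *m u) k 0 <= (N *m x) k 0.
  rewrite !mxE mulr_sumr; apply: ler_sum => l _.
  have [<-|kl] := eqVneq k l.
    by rewrite mulrCA /t divfK ?gt_eqF.
  rewrite mulrCA; apply: ler_wnM2l; first exact: Noff.
  by rewrite -ler_pdivrMr.
apply/negP; rewrite -ltNge; apply: (@le_lt_trans _ _ 0).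
  by have := Nx0 k 0; rewrite [X in _ <= X]mxE.
by rewrite mulr_gt0//; have := Nu0 k 0; rewrite mxE.
Qed.

Lemma omega_comparisonP (R : rcfType) (w : R) n (N : 'M[R]_n) (G : 'M[R[i]]_n) :
  (forall i, N i i <= omega_part w (G i i)) ->
  (forall i j, i != j -> cmod (G i j) <= - N i j) ->
  mxle N (omega_comparison w G).
Proof.
move=> d o i j; rewrite mxE; case: eqVneq => [<-|ij]; first exact: d.
by rewrite lerNr o.
Qed.

Lemma omega_comparison_off (R : rcfType) (w : R) n (N : 'M[R]_n) (G : 'M[R[i]]_n) :
  mxle N (omega_comparison w G) -> forall i j, i != j -> cmod (G i j) <= - N i j.
Proof.
by move=> NG i j ij; have := NG i j; rewrite mxE (negPf ij) lerNr.
Qed.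

Lemma omega_comparison_diag (R : rcfType) (w : R) n (N : 'M[R]_n) (G : 'M[R[i]]_n) :
  mxle N (omega_comparison w G) -> forall i, N i i <= omega_part w (G i i).
Proof. by move=> NG i; have := NG i i; rewrite mxE eqxx. Qed.

Lemma omega_comparison_Z (R : rcfType) (w : R) n (N : 'M[R]_n) (G : 'M[R[i]]_n) :
  mxle N (omega_comparison w G) -> forall i j, i != j -> N i j <= 0.
Proof.
move=> NG i j ij; rewrite -oppr_ge0.
exact: le_trans (cmod_ge0 _) (omega_comparison_off NG ij).
Qed.

(** Passing from G to G - H costs at most |H| in every entry of the comparison
    matrix, the diagonal ones included, since omega_part w is bounded by the
    modulus. *)
Lemma omega_comparison_sub (R : rcfType) (w : R) n (N P : 'M[R]_n) (G H : 'M[R[i]]_n) :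
  0 <= w <= 1 -> mxle N (omega_comparison w G) -> mxle (mxmod H) P ->
  mxle (N - P) (omega_comparison w (G - H)).
Proof.
move=> w01 NG HP; apply: omega_comparisonP => [i|i j ij]; rewrite !mxE.
  rewrite omega_partD omega_partN; apply: lerB (omega_comparison_diag NG i) _.
  by apply: le_trans (omega_part_le_cmod _ w01) _; have := HP i i; rewrite mxE.
rewrite opprB; apply: le_trans (cmodD _ _) _; rewrite cmodN addrC.
by apply: lerD; [have := HP i j; rewrite mxE|exact: omega_comparison_off NG _ _ ij].
Qed.

(** Generalized diagonal dominance: if G *m v = 0 then N *m |v| <= 0, hence
    |v| <= 0. The shift by z serves both to locate the spectrum and to solve
    Sylvester equations. *)
Lemma comparison_unitmx (R : rcfType) (w : R) n (N : 'M[R]_n)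
    (G : 'M[R[i]]_n) (u : 'cV[R]_n) (z : R[i]) :
  0 <= w <= 1 -> mxle N (omega_comparison w G) ->
  mxlt 0 u -> mxlt 0 (N *m u) -> 0 <= omega_part w z ->
  G + z%:M \in unitmx.
Proof.
move=> w01 NG u0 Nu0 z0.
(* Adding z to the diagonal can only raise its omega-parts. *)
have {z0} NG : mxle N (omega_comparison w (G + z%:M)).
  apply: omega_comparisonP => [i|i j ij]; rewrite !mxE.
    rewrite eqxx omega_partD; apply: le_trans (omega_comparison_diag NG i) _.
    by rewrite lerDl.
  by rewrite (negPf ij) addr0 (omega_comparison_off NG).
move: (G + _) NG => {}G NG.
rewrite -unitmx_tr -row_free_unit -kermx_eq0; apply/rowV0P => v /sub_kermxP vG.
have {vG} Gv : G *m v^T = 0 by rewrite -[RHS]trmx0 -vG trmx_mul trmxK.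
pose x := (mxmod v)^T.
have xE i : x i 0 = cmod (v 0 i) by rewrite !mxE.
(* Isolating the diagonal term in row i of G *m v = 0 bounds N *m |v| by 0. *)
have : mxle x 0.
  apply: (Mmatrix_inverse_positive (omega_comparison_Z NG) u0 Nu0) => i j.
  rewrite (ord1 j) [X in _ <= X]mxE mxE (bigD1 i)//= xE.
  have := congr1 (fun M : 'cV__ => M i 0) Gv.
  rewrite !mxE (bigD1 i)//= mxE => /eqP; rewrite addr_eq0 => /eqP Gi.
  rewrite -lerBrDr sub0r; apply: (@le_trans _ _ (cmod (G i i * v 0 i))).
    rewrite cmodM ler_wpM2r ?cmod_ge0//.
    by apply: le_trans (omega_comparison_diag NG i) _; apply: omega_part_le_cmod.
  rewrite Gi cmodN; apply: le_trans (cmod_sum _ _) _.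
  rewrite -sumrN; apply: ler_sum => l li.
  rewrite xE cmodM -mulNr mxE ler_wpM2r ?cmod_ge0//.
  by rewrite (omega_comparison_off NG)// eq_sym.
move=> x0; apply/rowP => i; rewrite [RHS]mxE; apply: cmod_eq0; apply: le_anti.
by rewrite cmod_ge0 andbT -xE; have := x0 i 0; rewrite [X in _ <= X]mxE.
Qed.

(** A half-plane version of the Gershgorin theorem. *)
Lemma comparison_upper_right_eigenvalue (R : rcfType) (w : R) n (N : 'M[R]_n)
    (G : 'M[R[i]]_n) (u : 'cV[R]_n) (a : R[i]) :
  0 <= w <= 1 -> mxle N (omega_comparison w G) ->
  mxlt 0 u -> mxlt 0 (N *m u) -> eigenvalue G a -> upper_right w a.
Proof.
move=> w01 NG u0 Nu0; rewrite /upper_right; case: ltP => // a0.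
rewrite /eigenvalue /eigenspace kermx_eq0 row_free_unit => /negP[].
by rewrite -raddfN; apply: (comparison_unitmx w01 NG u0 Nu0); rewrite omega_partN oppr_ge0.
Qed.

(** * Homogeneous Sylvester equations *)

(** From E P = - S E, every factor P - a to the right of E can be traded for a
    factor - (S + a) to its left. Doing so for all roots of the characteristic
    polynomial of P, which annihilates P, leaves a product of invertible matrices
    times E equal to 0. *)
Lemma sylvester_eq0 (F : closedFieldType) m n (E : 'M[F]_(m, n))
    (S : 'M[F]_m) (P : 'M[F]_n) :
  E *m P + S *m E = 0 ->
  (forall a, eigenvalue P a -> S + a%:M \in unitmx) -> E = 0.
Proof.
case: n E P => [|n] E P; first by rewrite (thinmx0 E).
move=> /eqP; rewrite addr_eq0 => /eqP ES Su.
have [rs charE] := closed_field_poly_normal (char_poly P).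
have {charE} charE : char_poly P = \prod_(z <- rs) ('X - z%:P).
  by rewrite charE (monicP (char_poly_monic P)) scale1r.
have {}Su : {in rs, forall z, S + z%:M \in unitmx}.
  move=> z zrs; apply: Su.
  by rewrite eigenvalue_root_char charE root_prod_XsubC.
have : E *m horner_mx P (\prod_(z <- rs) ('X - z%:P)) = 0.
  by rewrite -charE Cayley_Hamilton mulmx0.
elim: rs Su {charE} => [|z rs IH] Su.
  by rewrite big_nil rmorph1 mulmx1.
rewrite big_cons rmorphM /= rmorphB /= horner_mx_X horner_mx_C.
have mulE (X Y : 'M_n.+1) : E *m (X * Y) = E *m X *m Y by exact: mulmxA.
have EPz : E *m (P - z%:M) = - ((S + z%:M) *m E).
  by rewrite mulmxBr ES mul_mx_scalar mulmxDl mul_scalar_mx opprD.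
rewrite mulE EPz mulNmx -mulmxA => /eqP.
rewrite oppr_eq0 => /eqP/(congr1 (mulmx (invmx (S + z%:M)))).
rewrite mulmx0 mulKmx ?Su ?mem_head//; apply: IH => y yrs.
by rewrite Su// inE yrs orbT.
Qed.

(** It is essential that X occurs in one coefficient and Y in the other: for Y
    the solution constructed above and X any extremal one, the spectra of both
    coefficients are known. *)
Lemma riccati_sub_sylvester (K : comPzRingType) m n (A : 'M[K]_m) (B : 'M[K]_(m, n))
    (C : 'M[K]_(n, m)) (D : 'M[K]_n) (X Y : 'M[K]_(m, n)) :
  riccati A B C D X -> riccati A B C D Y ->
  (X - Y) *m (D - C *m X) + (A - Y *m C) *m (X - Y) = 0.
Proof.
move=> ricX ricY.
suff -> : (X - Y) *m (D - C *m X) + (A - Y *m C) *m (X - Y) =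
  (Y *m C *m Y - Y *m D - A *m Y + B) - (X *m C *m X - X *m D - A *m X + B).
  by rewrite [X in X - _]ricY [X in _ - X]ricX subrr.
rewrite !(mulmxBl, mulmxBr) !mulmxA; apply/matrixP => i j.
by rewrite !(addmxE, oppmxE); ring.
Qed.

(** * Majorized pairs of complex matrices *)

(** The real pair (T, T') controls both the size of Z' and the distance from Z to
    Z'; keeping the two bounds together makes the relation stable under products.
    For successive terms of two sequences, it is the comparison of a series with
    a convergent nonnegative one. *)
Definition majorized (R : rcfType) m n (Z Z' : 'M[R[i]]_(m, n))
    (T T' : 'M[R]_(m, n)) : Prop :=
  mxle (mxmod Z') T' /\ mxle (mxmod (Z - Z')) (T - T').

Lemma majorized_cst (R : rcfType) m n (Z : 'M[R[i]]_(m, n)) (T : 'M[R]_(m, n)) :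
  mxle (mxmod Z) T -> majorized Z Z T T.
Proof. by move=> ZT; split=> //; rewrite !subrr mxmod0; apply: mxle_refl. Qed.

Lemma majorized_le (R : rcfType) m n (Z Z' : 'M[R[i]]_(m, n)) (T T' : 'M[R]_(m, n)) :
  majorized Z Z' T T' -> mxle (mxmod Z) T.
Proof.
move=> [ZT dT]; rewrite -[Z](subrK Z') -[T](subrK T').
by apply: mxle_trans (mxmodD _ _) _; apply: mxleD.
Qed.

Lemma majorized_mono (R : rcfType) m n (Z Z' : 'M[R[i]]_(m, n)) (T T' : 'M[R]_(m, n)) :
  majorized Z Z' T T' -> mxle T' T.
Proof. by move=> [_ dT]; apply/mxle0_sub; apply: mxle_trans (mxmod_ge0 _) dT. Qed.

Lemma majorizedD (R : rcfType) m n (Z Z' W W' : 'M[R[i]]_(m, n))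
    (T T' U U' : 'M[R]_(m, n)) :
  majorized Z Z' T T' -> majorized W W' U U' ->
  majorized (Z + W) (Z' + W') (T + U) (T' + U').
Proof.
move=> [ZT dT] [WU dU]; split.
  by apply: mxle_trans (mxmodD _ _) _; apply: mxleD.
have dE (K : pzRingType) (x x' y y' : 'M[K]_(m, n)) :
    x + y - (x' + y') = (x - x') + (y - y') by rewrite opprD addrACA.
by rewrite !dE; apply: mxle_trans (mxmodD _ _) _; apply: mxleD.
Qed.

(** Both differences of products are expanded by the same identity
    x y - x' y' = (x - x') y + x' (y - y'), and compared term by term. *)
Lemma majorizedM (R : rcfType) m n p (Z Z' : 'M[R[i]]_(m, n))
    (W W' : 'M[R[i]]_(n, p)) (T T' : 'M[R]_(m, n)) (U U' : 'M[R]_(n, p)) :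
  majorized Z Z' T T' -> majorized W W' U U' ->
  majorized (Z *m W) (Z' *m W') (T *m U) (T' *m U').
Proof.
move=> maj_Z maj_W; have [ZT dT] := maj_Z; have [WU dU] := maj_W.
split; first exact: mxmod_mul_le.
have dE (K : pzRingType) (x x' : 'M[K]_(m, n)) (y y' : 'M[K]_(n, p)) :
    x *m y - x' *m y' = (x - x') *m y + x' *m (y - y').
  by rewrite mulmxBl mulmxBr addrA subrK.
rewrite !dE; apply: mxle_trans (mxmodD _ _) _; apply: mxleD.
  exact: mxmod_mul_le dT (majorized_le maj_W).
exact: mxmod_mul_le ZT dU.
Qed.

(** * The Jacobi iteration for Riccati equations *)

(** The sign makes it nonnegative for matrices with nonpositive off-diagonal
    entries. *)
Definition offdiagN (R : pzRingType) n (M : 'M[R]_n) : 'M[R]_n :=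
  \matrix_(i, j) if i == j then 0 else - M i j.

Lemma offdiagNE (R : pzRingType) n (M : 'M[R]_n) :
  M = diag_mx (\row_i M i i) - offdiagN M.
Proof.
apply/matrixP => i j; rewrite !mxE; case: eqVneq => [->|_].
  by rewrite subr0 mulr1n.
by rewrite mulr0n add0r opprK.
Qed.

Lemma offdiagN_majorized (R : rcfType) (w : R) n (N : 'M[R]_n) (G : 'M[R[i]]_n) :
  mxle N (omega_comparison w G) -> mxle (mxmod (offdiagN G)) (offdiagN N).
Proof.
move=> NG i j; rewrite !mxE; case: eqVneq => [_|ij]; first by rewrite cmod0.
by rewrite cmodN (omega_comparison_off NG).
Qed.

(** The left hand side of the Riccati equation is solved for the diagonal
    contribution A_ii X_ij + X_ij D_jj, the remaining terms being evaluated at the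
    previous iterate. *)
Definition jacobi (F : fieldType) m n (A : 'M[F]_m) (B : 'M[F]_(m, n))
    (C : 'M[F]_(n, m)) (D : 'M[F]_n) (X : 'M[F]_(m, n)) : 'M[F]_(m, n) :=
  \matrix_(i, j) ((X *m C *m X + X *m offdiagN D + offdiagN A *m X + B) i j
                  / (A i i + D j j)).

Lemma jacobi_residual (F : fieldType) m n (A : 'M[F]_m) (B : 'M[F]_(m, n))
    (C : 'M[F]_(n, m)) (D : 'M[F]_n) (X : 'M[F]_(m, n)) i j :
  A i i + D j j != 0 ->
  (A i i + D j j) * (jacobi A B C D X i j - X i j) =
  (X *m C *m X - X *m D - A *m X + B) i j.
Proof.
move=> nz; rewrite /jacobi mxE mulrBr mulrC divfK//.
have AX : (A *m X) i j = A i i * X i j - (offdiagN A *m X) i j.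
  by rewrite {1}[A]offdiagNE mulmxBl mxE mul_diag_mx !mxE.
have XD : (X *m D) i j = X i j * D j j - (X *m offdiagN D) i j.
  by rewrite {1}[D]offdiagNE mulmxBr mxE mul_mx_diag !mxE.
by rewrite !(addmxE, oppmxE) AX XD; ring.
Qed.

Lemma jacobi_fixed (F : fieldType) m n (A : 'M[F]_m) (B : 'M[F]_(m, n))
    (C : 'M[F]_(n, m)) (D : 'M[F]_n) (X : 'M[F]_(m, n)) :
  (forall i j, A i i + D j j != 0) ->
  jacobi A B C D X = X <-> riccati A B C D X.
Proof.
move=> nz; split=> fixX; apply/matrixP => i j.
  by rewrite -jacobi_residual// fixX subrr mulr0 mxE.
have := jacobi_residual B C X (nz i j); rewrite fixX [RHS]mxE => /eqP.
by rewrite mulf_eq0 (negPf (nz i j)) subr_eq0 => /eqP.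
Qed.

(** The hypotheses on Q and its tilde counterpart, read blockwise. They are
    symmetric under the exchange of (A, B) with (D, C), which is how the dual
    equation is reduced to the primal one. *)
Record riccati_majorant (R : rcfType) (w : R) m n (A : 'M[R[i]]_m)
    (B : 'M[R[i]]_(m, n)) (C : 'M[R[i]]_(n, m)) (D : 'M[R[i]]_n)
    (At : 'M[R]_m) (Bt : 'M[R]_(m, n)) (Ct : 'M[R]_(n, m)) (Dt : 'M[R]_n) :
    Prop := RiccatiMajorant {
  majorant_A : mxle At (omega_comparison w A);
  majorant_B : mxle (mxmod B) Bt;
  majorant_C : mxle (mxmod C) Ct;
  majorant_D : mxle Dt (omega_comparison w D);
  dominant_AB : mxlt (Bt *m (const_mx 1 : 'cV_n)) (At *m (const_mx 1 : 'cV_m));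
  dominant_DC : mxlt (Ct *m (const_mx 1 : 'cV_m)) (Dt *m (const_mx 1 : 'cV_n)) }.

Lemma majorant_diag_gt0 (R : rcfType) (w : R) k l (G : 'M[R[i]]_k) (N : 'M[R]_k)
    (H : 'M[R[i]]_(k, l)) (P : 'M[R]_(k, l)) :
  mxle N (omega_comparison w G) -> mxle (mxmod H) P ->
  mxlt (P *m (const_mx 1 : 'cV_l)) (N *m (const_mx 1 : 'cV_k)) ->
  forall i, 0 < N i i.
Proof.
move=> NG HP PN.
have N1 : mxlt 0 (N *m (const_mx 1 : 'cV_k)).
  apply: mxle_lt_trans PN; apply: mxle0_mul; last exact: mxle0_1.
  exact: mxmod_le_ge0 HP.
move=> i.
by case: (Zmatrix_gt0 (omega_comparison_Z NG) mxle0_1 N1 i).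
Qed.

Lemma majorant_sum_gt0 (R : rcfType) (w : R) m n (A : 'M[R[i]]_m)
    (B : 'M[R[i]]_(m, n)) (C : 'M[R[i]]_(n, m)) (D : 'M[R[i]]_n)
    (At : 'M[R]_m) (Bt : 'M[R]_(m, n)) (Ct : 'M[R]_(n, m)) (Dt : 'M[R]_n) :
  riccati_majorant w A B C D At Bt Ct Dt ->
  forall i j, 0 < At i i + Dt j j.
Proof.
move=> [AA BB CC DD BA CD] i j.
by rewrite addr_gt0 ?(majorant_diag_gt0 AA BB BA) ?(majorant_diag_gt0 DD CC CD).
Qed.

(** Off the diagonal the complex data are bounded by the real ones, and
    |A_ii + D_jj| >= omega_part w (A_ii + D_jj) >= At_ii + Dt_jj > 0 bounds the
    denominators. *)
Lemma jacobi_majorized (R : rcfType) (w : R) m n (A : 'M[R[i]]_m)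
    (B : 'M[R[i]]_(m, n)) (C : 'M[R[i]]_(n, m)) (D : 'M[R[i]]_n)
    (At : 'M[R]_m) (Bt : 'M[R]_(m, n)) (Ct : 'M[R]_(n, m)) (Dt : 'M[R]_n)
    (Z Z' : 'M[R[i]]_(m, n)) (T T' : 'M[R]_(m, n)) :
  0 <= w <= 1 -> riccati_majorant w A B C D At Bt Ct Dt ->
  majorized Z Z' T T' ->
  majorized (jacobi A B C D Z) (jacobi A B C D Z')
            (jacobi At Bt Ct Dt T) (jacobi At Bt Ct Dt T').
Proof.
move=> w01 maj majZ; have [AA BB CC DD _ _] := maj.
have diag_gt0 := majorant_sum_gt0 maj.
have diag_le i j : At i i + Dt j j <= cmod (A i i + D j j).
  apply: le_trans (omega_part_le_cmod _ w01); rewrite omega_partD.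
  by apply: lerD; apply: omega_comparison_diag.
have dvd_le (x : R[i]) (y : R) i j :
    cmod x <= y -> cmod (x / (A i i + D j j)) <= y / (At i i + Dt j j).
  move=> xy; rewrite cmodM cmodV ler_pM ?cmod_ge0 ?invr_ge0 ?cmod_ge0//.
  by rewrite lef_pV2 ?posrE// (lt_le_trans _ (diag_le i j)).
have := majorizedD (majorizedD (majorizedD
  (majorizedM (majorizedM majZ (majorized_cst CC)) majZ)
  (majorizedM majZ (majorized_cst (offdiagN_majorized DD))))
  (majorizedM (majorized_cst (offdiagN_majorized AA)) majZ))
  (majorized_cst BB).
rewrite /jacobi; move: (_ + B) (_ + B) (_ + Bt) (_ + Bt).
move=> N N' U U' [NU dU]; split=> i j.
  by have := NU i j; rewrite !mxE; exact: dvd_le.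
by have := dU i j; rewrite !mxE -!mulrBl; exact: dvd_le.
Qed.

Lemma jacobi_iterates_majorized (R : rcfType) (w : R) m n (A : 'M[R[i]]_m)
    (B : 'M[R[i]]_(m, n)) (C : 'M[R[i]]_(n, m)) (D : 'M[R[i]]_n)
    (At : 'M[R]_m) (Bt : 'M[R]_(m, n)) (Ct : 'M[R]_(n, m)) (Dt : 'M[R]_n) k :
  0 <= w <= 1 -> riccati_majorant w A B C D At Bt Ct Dt ->
  majorized (iter k.+1 (jacobi A B C D) 0) (iter k (jacobi A B C D) 0)
            (iter k.+1 (jacobi At Bt Ct Dt) 0) (iter k (jacobi At Bt Ct Dt) 0).
Proof.
move=> w01 maj; elim: k => [|k IH]; last first.
  exact: jacobi_majorized w01 maj IH.
have J0 : mxle (mxmod (jacobi A B C D 0)) (jacobi At Bt Ct Dt 0).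
  apply: majorized_le (jacobi_majorized w01 maj _).
  by apply: majorized_cst; rewrite mxmod0; apply: mxle_refl.
split; rewrite /= ?subr0// mxmod0; exact: mxle_refl.
Qed.

(** The case Z = Z' = 0 of the comparison of Jacobi steps. *)
Lemma jacobi_le (R : rcfType) (w : R) m n (A : 'M[R[i]]_m)
    (B : 'M[R[i]]_(m, n)) (C : 'M[R[i]]_(n, m)) (D : 'M[R[i]]_n)
    (At : 'M[R]_m) (Bt : 'M[R]_(m, n)) (Ct : 'M[R]_(n, m)) (Dt : 'M[R]_n)
    (T T' : 'M[R]_(m, n)) :
  0 <= w <= 1 -> riccati_majorant w A B C D At Bt Ct Dt ->
  mxle 0 T' -> mxle T' T -> mxle (jacobi At Bt Ct Dt T') (jacobi At Bt Ct Dt T).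
Proof.
move=> w01 maj T'0 TT.
have maj0 : majorized (0 : 'M[R[i]]_(m, n)) 0 T T'.
  by split; rewrite ?subrr mxmod0//; apply/mxle0_sub.
exact: majorized_mono (jacobi_majorized w01 maj maj0).
Qed.

(** Row sums at most 1 propagate along the increasing iteration: multiplying
    dA T' + T' dD = T C T + T offdiagN D + offdiagN A T + B by the vector 1 and
    using T 1 <= 1 gives dA T' 1 <= dA 1 + (B - A) 1 - T' (D - C) 1 <= dA 1. *)
Lemma jacobi_row_sum (R : realFieldType) m n (A : 'M[R]_m) (B : 'M[R]_(m, n))
    (C : 'M[R]_(n, m)) (D : 'M[R]_n) (T : 'M[R]_(m, n)) :
  let T' := jacobi A B C D T in
  (forall i j, i != j -> A i j <= 0) -> (forall i j, i != j -> D i j <= 0) ->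
  mxle 0 C -> (forall i, 0 < A i i) -> (forall j, 0 < D j j) ->
  mxle (B *m (const_mx 1 : 'cV_n)) (A *m (const_mx 1 : 'cV_m)) ->
  mxle (C *m (const_mx 1 : 'cV_m)) (D *m (const_mx 1 : 'cV_n)) ->
  mxle 0 T -> mxle T T' ->
  mxle (T *m (const_mx 1 : 'cV_n)) (const_mx 1) ->
  mxle (T' *m (const_mx 1 : 'cV_n)) (const_mx 1).
Proof.
move=> T' Aoff Doff C0 A0 D0 BA CD T0 TT T1.
pose one k := const_mx 1 : 'cV[R]_k.
pose dA := diag_mx (\row_i A i i); pose dD := diag_mx (\row_j D j j).
have off0 k (M : 'M[R]_k) :
    (forall i j, i != j -> M i j <= 0) -> mxle 0 (offdiagN M).
  by move=> Moff i j; rewrite !mxE; case: eqVneq => // ij; rewrite oppr_ge0 Moff.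
have T'E : dA *m T' + T' *m dD =
    T *m C *m T + T *m offdiagN D + offdiagN A *m T + B.
  apply/matrixP => i j; rewrite /T' /jacobi.
  move: (_ + B) => N; rewrite mxE mul_diag_mx mul_mx_diag !mxE.
  by field; rewrite gt_eqF// addr_gt0.
have {}T'E : dA *m (T' *m one n) =
    T *m C *m (T *m one n) + T *m (offdiagN D *m one n)
    + offdiagN A *m (T *m one n) + B *m one n - T' *m (dD *m one n).
  by rewrite !mulmxA -!mulmxDl -mulmxBl -T'E addrK.
have T'0 : mxle 0 T' := mxle_trans T0 TT.
have DE : dD *m one n = D *m one n + offdiagN D *m one n.
  by rewrite {1}[D]offdiagNE -mulmxDl subrK.
have AE : dA *m one m = A *m one m + offdiagN A *m one m.
  by rewrite {1}[A]offdiagNE -mulmxDl subrK.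
have T'1 : mxle (dA *m (T' *m one n)) (dA *m one m).
  (* Every T multiplying a nonnegative matrix on its left is raised to T', so as
     to recombine with the term T' *m dD. *)
  have C1 : mxle (T *m C *m (T *m one n)) (T' *m (C *m one m)).
    apply: mxle_trans (mxle_mull (mxle0_mul T0 C0) T1) _; rewrite -mulmxA.
    by apply: mxle_mul => //; apply: mxle0_mul => //; apply: mxle0_1.
  have D1 : mxle (T *m (offdiagN D *m one n)) (T' *m (offdiagN D *m one n)).
    apply: mxle_mul => //; apply: mxle0_mul; [exact: off0|exact: mxle0_1].
  have A1 := mxle_mull (off0 _ _ Aoff) T1.
  have CD1 := mxle_mull T'0 CD.
  rewrite T'E DE mulmxDr AE.
  move=> i j; move: (C1 i j) (D1 i j) (A1 i j) (CD1 i j) (BA i j).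
  by rewrite !(addmxE, oppmxE) /one; lra.
move=> i j; rewrite (ord1 j); have := T'1 i 0.
by rewrite !mul_diag_mx !mxE ler_pM2l.
Qed.

(** * Limits of majorized sequences *)

(** Stated for any subadditive function, so as to cover real absolute values and
    complex moduli alike. *)
Lemma increments_majorant (R : numDomainType) (V : zmodType) (nu : V -> R)
    (x : nat -> V) (t : nat -> R) :
  nu 0 = 0 -> (forall y z, nu (y + z) <= nu y + nu z) ->
  (forall k, nu (x k.+1 - x k) <= t k.+1 - t k) ->
  forall k l, nu (x (k + l)%N - x k) <= t (k + l)%N - t k.
Proof.
move=> nu0 nuD dx k; elim=> [|l IH]; first by rewrite addn0 !subrr nu0.
rewrite addnS -(subrKA (x (k + l)%N)) -[leRHS](subrKA (t (k + l)%N)).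
by apply: le_trans (nuD _ _) _; apply: lerD.
Qed.

Lemma real_limit_majorant (R : realType) (x t : nat -> R) (tl : R) :
  t @ \oo --> tl -> (forall k, `|x k.+1 - x k| <= t k.+1 - t k) ->
  exists xl, forall k, `|xl - x k| <= tl - t k.
Proof.
move=> ttl dx.
have tinc : nondecreasing_seq t.
  by apply/nondecreasing_seqP => k; rewrite -subr_ge0; apply: le_trans (dx k).
have tle k : t k <= tl.
  have tc : cvgn t by apply/cvg_ex; exists tl.
  by rewrite -(cvg_lim (@Rhausdorff R) ttl); apply: nondecreasing_cvgn_le.
have dist := increments_majorant (normr0 _) (@ler_normD _ _) dx.
(* The bound on the increments of x makes x + t nondecreasing. *)
pose y k := x k + t k.
have yinc : nondecreasing_seq y.
  apply/nondecreasing_seqP => k; rewrite /y.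
  by have := dx k; rewrite ler_norml => /andP[]; lra.
have yc : cvgn y.
  apply: nondecreasing_is_cvgn => //; exists (x 0%N + tl *+ 2 - t 0%N) => _ [k _ <-].
  have := dist 0%N k; rewrite add0n ler_norml /y => /andP[_].
  by have := tle k; rewrite mulr2n; lra.
have xl : x @ \oo --> limn y - tl.
  have -> : x = (fun k => y k - t k) by apply: funext => k; rewrite /y addrK.
  exact: cvgB yc ttl.
exists (limn y - tl) => k.
apply: (@ler_cvg_to _ \oo _ _ (fun l => `|x l - x k|) (fun l => t l - t k)).
- by apply: cvg_norm; apply: cvgB xl (cvg_cst _).
- exact: cvgB ttl (cvg_cst _).
- by exists k => // l /= kl; rewrite -(subnKC kl) dist.
Qed.

Lemma complex_limit_majorant (R : realType) (z : nat -> R[i]) (t : nat -> R) (tl : R) :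
  t @ \oo --> tl -> (forall k, cmod (z k.+1 - z k) <= t k.+1 - t k) ->
  exists zl, forall k, cmod (zl - z k) <= tl - t k.
Proof.
move=> ttl dz.
have [k|a aP] := @real_limit_majorant R (fun k => complex.Re (z k)) _ _ ttl.
  by rewrite -raddfB; apply: le_trans (Re_le_cmod _) (dz k).
have [k|b bP] := @real_limit_majorant R (fun k => complex.Im (z k)) _ _ ttl.
  by rewrite -raddfB; apply: le_trans (Im_le_cmod _) (dz k).
exists (Complex a b) => k.
have dist := increments_majorant (cmod0 R) (@cmodD R) dz k.
(* Combining the two real bounds directly would lose a factor 2; it is paid only
   on the tail tl - t l, which vanishes as l grows. *)
apply: (@ler_cvg_to _ \oo _ _ (fun=> cmod (Complex a b - z k))
         (fun l => (tl - t l) + (tl - t l) + (t l - t k))).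
- exact: cvg_cst.
- rewrite -[X in _ --> X]add0r; apply: cvgD; last exact: cvgB ttl (cvg_cst _).
  rewrite -(addr0 0) -(subrr tl).
  by apply: cvgD; apply: cvgB ttl; apply: cvg_cst.
exists k => // l /= kl; rewrite -(subnKC kl); move: (l - k)%N => {kl}l.
rewrite -[X in cmod X](subrKA (z (k + l)%N)).
apply: le_trans (cmodD _ _) _; apply: lerD (dist l).
have := aP (k + l)%N; have := bP (k + l)%N; case: (z (k + l)%N) => c d /=.
set e := tl - _ => bd ac; rewrite cmodE /=.
apply: (@le_trans _ _ (`|a - c| + `|b - d|)); last exact: lerD.
rewrite -[leRHS]ger0_norm ?addr_ge0//.
rewrite -[leRHS]sqrtr_sqr ler_wsqrtr// [leRHS]sqrrD !real_normK ?num_real// lerD2r lerDl.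
by rewrite mulrn_wge0// mulr_ge0.
Qed.

Definition mxcvg (R : realType) m n (X : nat -> 'M[R]_(m, n)) (L : 'M[R]_(m, n)) :
    Prop := forall i j, (fun k => X k i j) @ \oo --> L i j.

Lemma mxcvg_cst (R : realType) m n (L : 'M[R]_(m, n)) : mxcvg (fun=> L) L.
Proof. by move=> i j; exact: cvg_cst. Qed.

Lemma mxcvgD (R : realType) m n (X Y : nat -> 'M[R]_(m, n)) (L M : 'M[R]_(m, n)) :
  mxcvg X L -> mxcvg Y M -> mxcvg (fun k => X k + Y k) (L + M).
Proof.
move=> XL YM i j; rewrite mxE; under [X in X @ _]eq_fun do rewrite mxE.
exact: cvgD (XL i j) (YM i j).
Qed.

Lemma mxcvgM (R : realType) m n p (X : nat -> 'M[R]_(m, n)) (Y : nat -> 'M[R]_(n, p))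
    (L : 'M[R]_(m, n)) (M : 'M[R]_(n, p)) :
  mxcvg X L -> mxcvg Y M -> mxcvg (fun k => X k *m Y k) (L *m M).
Proof.
move=> XL YM i j; rewrite mxE; under [X in X @ _]eq_fun do rewrite mxE.
elim: (index_enum _) => [|l r IH].
  by rewrite big_nil; under [X in X @ _]eq_fun do rewrite big_nil; exact: cvg_cst.
rewrite big_cons; under [X in X @ _]eq_fun do rewrite big_cons.
exact: cvgD (cvgM (XL i l) (YM l j)) IH.
Qed.

Lemma mxcvg_jacobi (R : realType) m n (A : 'M[R]_m) (B : 'M[R]_(m, n))
    (C : 'M[R]_(n, m)) (D : 'M[R]_n) (X : nat -> 'M[R]_(m, n)) (L : 'M[R]_(m, n)) :
  mxcvg X L -> mxcvg (fun k => jacobi A B C D (X k)) (jacobi A B C D L).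
Proof.
move=> XL i j; rewrite /jacobi mxE; under [X in X @ _]eq_fun do rewrite mxE.
apply: cvgM; last exact: cvg_cst.
have cst := @mxcvg_cst R.
exact: (mxcvgD (mxcvgD (mxcvgD (mxcvgM (mxcvgM XL (cst _ _ C)) XL)
  (mxcvgM XL (cst _ _ (offdiagN D)))) (mxcvgM (cst _ _ (offdiagN A)) XL))
  (cst _ _ B)).
Qed.

(** * Convergence of the Jacobi iterates *)

(** The iterates increase below PhiT, so they converge to a solution, which is
    PhiT by minimality; PhiT therefore inherits the bound on the row sums. *)
Lemma jacobi_iterates_cvg (R : realType) (w : R) m n (A : 'M[R[i]]_m)
    (B : 'M[R[i]]_(m, n)) (C : 'M[R[i]]_(n, m)) (D : 'M[R[i]]_n)
    (At : 'M[R]_m) (Bt : 'M[R]_(m, n)) (Ct : 'M[R]_(n, m)) (Dt : 'M[R]_n)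
    (PhiT : 'M[R]_(m, n)) :
  0 <= w <= 1 -> riccati_majorant w A B C D At Bt Ct Dt ->
  minimal_nonneg (riccati At Bt Ct Dt) PhiT ->
  mxcvg (fun k => iter k (jacobi At Bt Ct Dt) 0) PhiT /\
  mxle (PhiT *m (const_mx 1 : 'cV_n)) (const_mx 1).
Proof.
move=> w01 maj [ricP P0 Pmin]; have [AA BB CC DD BA CD] := maj.
have sum_neq0 i j : At i i + Dt j j != 0 by rewrite gt_eqF// (majorant_sum_gt0 maj).
pose T k := iter k (jacobi At Bt Ct Dt) 0.
have Tinc k : mxle (T k) (T k.+1) := majorized_mono (jacobi_iterates_majorized k w01 maj).
have T0 k : mxle 0 (T k).
  by elim: k => [|k IH]; [exact: mxle_refl|exact: mxle_trans (Tinc k)].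
have TP k : mxle (T k) PhiT.
  elim: k => [//|k IH].
  rewrite -(proj2 (jacobi_fixed Bt Ct PhiT sum_neq0) ricP).
  exact: jacobi_le w01 maj (T0 k) IH.
have T1 k : mxle (T k *m (const_mx 1 : 'cV_n)) (const_mx 1).
  elim: k => [|k IH]; first by rewrite mul0mx; apply: mxle0_1.
  apply: jacobi_row_sum (T0 k) (Tinc k) IH.
  - exact: omega_comparison_Z AA.
  - exact: omega_comparison_Z DD.
  - exact: mxmod_le_ge0 CC.
  - exact: majorant_diag_gt0 AA BB BA.
  - exact: majorant_diag_gt0 DD CC CD.
  - exact: mxltW.
  - exact: mxltW.
pose L := \matrix_(i, j) limn (fun k => T k i j) : 'M[R]_(m, n).
have TL : mxcvg T L.
  move=> i j; rewrite mxE; apply: nondecreasing_is_cvgn.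
    by apply/nondecreasing_seqP => k; apply: Tinc.
  by exists (PhiT i j) => _ [k _ <-]; apply: TP.
have mxcvg_ge k l (X : nat -> 'M[R]_(k, l)) Y M :
    mxcvg X Y -> (forall N, mxle M (X N)) -> mxle M Y.
  move=> XY MX i j; apply: (cvgr_to_ge (XY i j)).
  by exists 0%N => // N _; apply: MX.
have mxcvg_le k l (X : nat -> 'M[R]_(k, l)) Y M :
    mxcvg X Y -> (forall N, mxle (X N) M) -> mxle Y M.
  move=> XY MX i j; apply: (cvgr_to_le (XY i j)).
  by exists 0%N => // N _; apply: MX.
have ricL : riccati At Bt Ct Dt L.
  apply/(jacobi_fixed Bt Ct L sum_neq0)/matrixP => i j.
  have := @mxcvg_jacobi R m n At Bt Ct Dt T L TL i j => JL.
  have SL : (fun k => T k.+1 i j) @ \oo --> L i j.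
    by have := TL i j; rewrite -cvg_shiftS.
  exact: cvg_unique (@Rhausdorff R) _ _ _ _ JL SL.
(* L is below the minimal solution as a limit of smaller iterates, and above it
   by minimality. *)
have LP : L = PhiT.
  apply: mxle_anti; first exact: (mxcvg_le _ _ _ _ _ TL TP).
  by apply: Pmin => //; apply: (mxcvg_ge _ _ _ _ _ TL T0).
rewrite -LP; split; first exact: TL.
have TL1 := mxcvgM TL (@mxcvg_cst R _ _ (const_mx 1 : 'cV_n)).
exact: (mxcvg_le _ _ _ _ _ TL1 T1).
Qed.

(** The complex iterates are Cauchy because their increments are bounded by those
    of the convergent real iterates. *)
Lemma jacobi_limit_solution (R : realType) (w : R) m n (A : 'M[R[i]]_m)
    (B : 'M[R[i]]_(m, n)) (C : 'M[R[i]]_(n, m)) (D : 'M[R[i]]_n)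
    (At : 'M[R]_m) (Bt : 'M[R]_(m, n)) (Ct : 'M[R]_(n, m)) (Dt : 'M[R]_n)
    (PhiT : 'M[R]_(m, n)) :
  0 <= w <= 1 -> riccati_majorant w A B C D At Bt Ct Dt ->
  riccati At Bt Ct Dt PhiT ->
  mxcvg (fun k => iter k (jacobi At Bt Ct Dt) 0) PhiT ->
  exists Phi, riccati A B C D Phi /\ mxle (mxmod Phi) PhiT.
Proof.
move=> w01 maj ricP TP; have [AA BB CC DD BA CD] := maj.
have sumt_gt0 := majorant_sum_gt0 maj.
have sumt_neq0 i j : At i i + Dt j j != 0 by rewrite gt_eqF.
have sum_neq0 i j : A i i + D j j != 0.
  apply/eqP => AD0; have := sumt_gt0 i j; rewrite ltNge => /negP[].
  apply: (@le_trans _ _ (omega_part w (A i i + D j j))).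
    by rewrite omega_partD; apply: lerD; apply: omega_comparison_diag.
  by rewrite AD0 (le_trans (omega_part_le_cmod _ w01))// cmod0.
pose T k := iter k (jacobi At Bt Ct Dt) 0.
pose Z k := iter k (jacobi A B C D) 0.
have majZ k : majorized (Z k.+1) (Z k) (T k.+1) (T k) :=
  jacobi_iterates_majorized k w01 maj.
have lim ij : exists z, forall k, cmod (z - Z k ij.1 ij.2) <= PhiT ij.1 ij.2 - T k ij.1 ij.2.
  apply: complex_limit_majorant; first exact: TP.
  by move=> k; have := (majZ k).2 ij.1 ij.2; rewrite !mxE.
have [phi phiP] := choice lim.
pose Phi := \matrix_(i, j) phi (i, j) : 'M[R[i]]_(m, n).
have majPhi k : majorized Phi (Z k) PhiT (T k).
  split; first exact: (majZ k).1.
  by move=> i j; rewrite !mxE; apply: (phiP (i, j)).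
exists Phi; split; last exact: majorized_le (majPhi 0%N).
apply/(jacobi_fixed B C Phi sum_neq0)/matrixP => i j.
apply/eqP; rewrite -subr_eq0; apply/eqP; apply: cmod_eq0; apply: le_anti.
rewrite cmod_ge0 andbT.
(* For every k, Phi and its image under the Jacobi map are both within
   PhiT - T_(k+1) of Z_(k+1). *)
apply: (@ler_cvg_to _ \oo _ _ (fun=> cmod (jacobi A B C D Phi i j - Phi i j))
  (fun k => (PhiT i j - T k.+1 i j) + (PhiT i j - T k.+1 i j))).
- exact: cvg_cst.
- have SL : (fun k => PhiT i j - T k.+1 i j) @ \oo --> 0.
    rewrite -(subrr (PhiT i j)); apply: cvgB (cvg_cst _) _.
    by have := TP i j; rewrite -cvg_shiftS.
  by rewrite -(addr0 0); apply: cvgD.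
exists 0%N => // k _ /=.
have modE (M : 'M[R[i]]_(m, n)) : mxmod M i j = cmod (M i j) by rewrite mxE.
rewrite -[X in cmod X](subrKA (Z k.+1 i j)).
apply: le_trans (cmodD _ _) _; apply: lerD.
  have [_ dJ] := jacobi_majorized w01 maj (majPhi k).
  have := dJ i j; rewrite (proj2 (jacobi_fixed Bt Ct PhiT sumt_neq0) ricP).
  by rewrite modE !addmxE !oppmxE.
rewrite -cmodN opprB; have := (majPhi k.+1).2 i j.
by rewrite modE !addmxE !oppmxE.
Qed.

(** * Closed-loop matrices and extremal solutions *)

Lemma closed_loop_row_dominant (R : numDomainType) m n (C : 'M[R]_(n, m))
    (D : 'M[R]_n) (X : 'M[R]_(m, n)) :
  mxle 0 C -> mxlt (C *m (const_mx 1 : 'cV_m)) (D *m (const_mx 1 : 'cV_n)) ->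
  mxle (X *m (const_mx 1 : 'cV_n)) (const_mx 1) ->
  mxlt 0 ((D - C *m X) *m (const_mx 1 : 'cV_n)).
Proof.
move=> C0 CD X1; rewrite mulmxBl -mulmxA; apply/mxlt0_sub.
by apply: mxle_lt_trans CD; apply: mxle_mull.
Qed.

(** By the Riccati equation (A - X C) (1 - X 1) = (A - B) 1 + X (D - C) 1, so
    that 1 - X 1 can certify that A - X C is an M-matrix. The vector 1 itself
    would not do, as C is controlled by D and not by A. *)
Lemma dual_closed_loop_dominant (R : numDomainType) m n (A : 'M[R]_m)
    (B : 'M[R]_(m, n)) (C : 'M[R]_(n, m)) (D : 'M[R]_n) (X : 'M[R]_(m, n)) :
  mxlt (B *m (const_mx 1 : 'cV_n)) (A *m (const_mx 1 : 'cV_m)) ->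
  mxle (C *m (const_mx 1 : 'cV_m)) (D *m (const_mx 1 : 'cV_n)) ->
  mxle 0 X -> riccati A B C D X ->
  mxlt 0 ((A - X *m C) *m (const_mx 1 - X *m (const_mx 1 : 'cV_n))).
Proof.
move=> BA CD X0 ric.
have -> : (A - X *m C) *m (const_mx 1 - X *m (const_mx 1 : 'cV_n)) =
    (A *m (const_mx 1 : 'cV_m) - B *m (const_mx 1 : 'cV_n))
    + X *m (D *m (const_mx 1 : 'cV_n) - C *m (const_mx 1 : 'cV_m)).
  have {ric} := congr1 (mulmx^~ (const_mx 1 : 'cV_n)) ric.
  rewrite mul0mx mulmxBr !mulmxBl !mulmxDl !mulNmx mulmxBr !mulmxA => ric.
  apply/eqP; rewrite -subr_eq0; apply/eqP; rewrite -ric.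
  apply/matrixP => i j.
  by rewrite !(addmxE, oppmxE); ring.
apply: mxlt_le_trans (proj2 (mxlt0_sub _ _) BA) _.
rewrite -[X in mxle X _]addr0; apply: mxleD; first exact: mxle_refl.
by apply: mxle0_mul => //; apply/mxle0_sub.
Qed.

(** Existence comes from the Jacobi iteration. A solution bounded by PhiT is
    extremal by diagonal dominance of D - C X, and an extremal solution equals
    Phi by the Sylvester equation, so both uniqueness claims follow at once. *)
Lemma majorized_solution_extremal (R : realType) (w : R) m n (A : 'M[R[i]]_m)
    (B : 'M[R[i]]_(m, n)) (C : 'M[R[i]]_(n, m)) (D : 'M[R[i]]_n)
    (At : 'M[R]_m) (Bt : 'M[R]_(m, n)) (Ct : 'M[R]_(n, m)) (Dt : 'M[R]_n)
    (PhiT : 'M[R]_(m, n)) :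
  0 <= w <= 1 -> riccati_majorant w A B C D At Bt Ct Dt ->
  minimal_nonneg (riccati At Bt Ct Dt) PhiT ->
  exists Phi : 'M[R[i]]_(m, n),
    [/\ unique (fun X => riccati A B C D X /\ mxle (mxmod X) PhiT) Phi,
        D - C *m Phi \in unitmx,
        forall i, upper_right w ((D - C *m Phi) i i)
      & unique (extremal_solution w A B C D) Phi].
Proof.
move=> w01 maj minP; have [ricP P0 _] := minP; have [AA BB CC DD BA CD] := maj.
have [TP P1] := jacobi_iterates_cvg w01 maj minP.
have [Phi [ricPhi PhiP]] := jacobi_limit_solution w01 maj ricP TP.
have DC_dom X : mxle (mxmod X) PhiT ->
    mxle (Dt - Ct *m PhiT) (omega_comparison w (D - C *m X)).
  by move=> XP; apply: omega_comparison_sub => //; apply: mxmod_mul_le.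
have DC1 := closed_loop_row_dominant (mxmod_le_ge0 CC) CD P1.
have one0 : mxlt 0 (const_mx 1 : 'cV[R]_n) := mxlt0_1.
have AC_dom : mxle (At - PhiT *m Ct) (omega_comparison w (A - Phi *m C)).
  by apply: omega_comparison_sub => //; apply: mxmod_mul_le.
pose u := const_mx 1 - PhiT *m (const_mx 1 : 'cV_n) : 'cV[R]_m.
have ACu : mxlt 0 ((At - PhiT *m Ct) *m u).
  exact: dual_closed_loop_dominant BA (mxltW CD) P0 ricP.
have u0 : mxlt 0 u.
  move=> i j; rewrite (ord1 j) [X in X < _]mxE.
  have u_ge0 : mxle 0 u by apply/mxle0_sub.
  by case: (Zmatrix_gt0 (omega_comparison_Z AC_dom) u_ge0 ACu i).
have ext X : riccati A B C D X -> mxle (mxmod X) PhiT ->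
    extremal_solution w A B C D X.
  move=> ricX XP; split=> // a.
  exact: comparison_upper_right_eigenvalue w01 (DC_dom X XP) one0 DC1.
have uniq X : extremal_solution w A B C D X -> Phi = X.
  move=> [ricX eigX]; apply/esym/eqP; rewrite -subr_eq0; apply/eqP.
  apply: sylvester_eq0 (riccati_sub_sylvester ricX ricPhi) _ => a /eigX a0.
  exact: comparison_unitmx w01 AC_dom u0 ACu (ltW a0).
exists Phi; split.
- by split=> // X [ricX XP]; apply: uniq; apply: ext.
- rewrite -[_ - _]addr0 -(raddf0 (@scalar_mx _ n)).
  apply: comparison_unitmx w01 (DC_dom Phi PhiP) one0 DC1 _.
  by rewrite /omega_part /= !mulr0 addr0.
- move=> i; apply: lt_le_trans (omega_comparison_diag (DC_dom Phi PhiP) i).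
  have DCZ := omega_comparison_Z (DC_dom Phi PhiP).
  by case: (Zmatrix_gt0 DCZ (mxltW one0) DC1 i).
- by split; [exact: ext|exact: uniq].
Qed.

Lemma block_majorant (R : rcfType) (w : R) m n (A : 'M[R[i]]_m)
    (B : 'M[R[i]]_(m, n)) (C : 'M[R[i]]_(n, m)) (D : 'M[R[i]]_n)
    (At : 'M[R]_m) (Bt : 'M[R]_(m, n)) (Ct : 'M[R]_(n, m)) (Dt : 'M[R]_n) :
  let Qt := block_mx Dt (- Ct) (- Bt) At in
  mxle Qt (omega_comparison w (block_mx D (- C) (- B) A)) ->
  mxlt 0 (Qt *m (const_mx 1 : 'cV_(n + m))) ->
  riccati_majorant w A B C D At Bt Ct Dt.
Proof.
move=> Qt QQ Q1.
have one : (const_mx 1 : 'cV[R]_(n + m)) = col_mx (const_mx 1) (const_mx 1).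
  by rewrite col_mx_const.
move: Q1; rewrite one mul_block_col => Q1; split.
- move=> i j; have := QQ (rshift n i) (rshift n j).
  rewrite /Qt [X in _ <= X]mxE !block_mxEdr (inj_eq (@rshift_inj _ _)).
  by rewrite [X in _ -> _ <= X]mxE.
- move=> i j; have := QQ (rshift n i) (lshift m j).
  by rewrite /Qt [X in _ <= X]mxE !block_mxEdl eq_rlshift !mxE cmodN lerN2.
- move=> i j; have := QQ (lshift m i) (rshift n j).
  by rewrite /Qt [X in _ <= X]mxE !block_mxEur eq_lrshift !mxE cmodN lerN2.
- move=> i j; have := QQ (lshift m i) (lshift m j).
  rewrite /Qt [X in _ <= X]mxE !block_mxEul (inj_eq (@lshift_inj _ _)).
  by rewrite [X in _ -> _ <= X]mxE.
- apply/mxlt0_sub => i j; have := Q1 (rshift n i) j.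
  by rewrite col_mxEd mulNmx addrC [X in X < _]mxE [X in _ -> X < _]mxE.
- apply/mxlt0_sub => i j; have := Q1 (lshift m i) j.
  by rewrite col_mxEu mulNmx [X in X < _]mxE [X in _ -> X < _]mxE.
Qed.

Theorem theorem3p1 (R : realType) (m n : nat) (w : R)
    (A : 'M[R[i]]_m) (B : 'M[R[i]]_(m, n))
    (C : 'M[R[i]]_(n, m)) (D : 'M[R[i]]_n)
    (At : 'M[R]_m) (Bt : 'M[R]_(m, n)) (Ct : 'M[R]_(n, m)) (Dt : 'M[R]_n)
    (PhiT : 'M[R]_(m, n)) (PsiT : 'M[R]_(n, m)) :
  let Q : 'M[R[i]]_(n + m) := block_mx D (- C) (- B) A in
  let Qw := omega_comparison w Q in
  let Qt : 'M[R]_(n + m) := block_mx Dt (- Ct) (- Bt) At in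
  let ones : 'cV[R]_(n + m) := const_mx 1 in
  0 <= w <= 1 ->
  nonsingular_Mmatrix Qw -> mxlt 0 (Qw *m ones) ->
  nonsingular_Mmatrix Qt -> mxle Qt Qw -> mxlt 0 (Qt *m ones) ->
  minimal_nonneg (riccati At Bt Ct Dt) PhiT ->
  minimal_nonneg (riccati Dt Ct Bt At) PsiT ->
  (exists Phi : 'M[R[i]]_(m, n),
    [/\ unique (fun X => riccati A B C D X /\ mxle (mxmod X) PhiT) Phi,
        D - C *m Phi \in unitmx,
        forall i, upper_right w ((D - C *m Phi) i i)
      & unique (extremal_solution w A B C D) Phi])
  /\
  (exists Psi : 'M[R[i]]_(n, m),
    [/\ unique (fun Y => riccati D C B A Y /\ mxle (mxmod Y) PsiT) Psi,
        A - B *m Psi \in unitmx,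
        forall i, upper_right w ((A - B *m Psi) i i)
      & unique (extremal_solution w D C B A) Psi]).
Proof.
move=> Q Qw Qt ones w01 _ _ _ QtQw Qt1 minPhi minPsi.
have maj := block_majorant QtQw Qt1.
split; first exact: majorized_solution_extremal w01 maj minPhi.
(* The dual data satisfy the same bounds, with the roles exchanged. *)
have [AA BB CC DD BA CD] := maj.
by apply: majorized_solution_extremal minPsi.
Qed.
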